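(* Let $d\ge1$ and let $U\subset\mathbb{R}^d$ be an open bounded connected set of diameter $h_U$. Let two integers $l\ge0$ and $n\ge1$ be fixed, and let $\mathcal{P}$ be a subspace of $\mathbb{P}^l(U)^n$. Consider the $L^2$-orthogonal projector $\Pi_{\mathcal{P}}:L^1(U)^n\to\mathcal{P}$ such that, for all $\Phi\in L^1(U)^n$, $$\int_U(\Pi_{\mathcal{P}}\Phi-\Phi)\cdot\Psi=0\quad\text{for all }\Psi\in\mathcal{P}.$$ Let $p\in[1,+\infty]$. Let $r_U$ be the inradius of $U$ and assume that there is a real number $\delta$ such that $$\frac{r_U}{h_U}\ge\delta>0.$$ Then there exists a real number $C>0$ depending only on $n$, $d$, $\delta$, $l$, and $p$ such that $$\forall\Phi\in L^p(U)^n:\quad\|\Pi_{\mathcal{P}}\Phi\|_{L^p(U)^n}\le C\|\Phi\|_{L^p(U)^n}.$$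
   Context: $\mathbb{P}^l(U)$ is the space of (restrictions to $U$ of) $d$-variate polynomials of total degree at most $l$. The inradius of $U$ is the radius of the largest ball contained in $U$. *)

(* Defs.v *)
From HB Require Import structures.
From mathcomp Require Import all_boot all_order all_algebra.
(* mpoly shares notations and names (e.g. isMeasure) with MathComp-Analysis: the
   former are not imported, and the latter are overridden by the next import. *)
From mathcomp Require Import -(notations) mpoly.
From mathcomp Require Import all_classical all_reals all_analysis.

Set Implicit Arguments.
Unset Strict Implicit.
Unset Printing Implicit Defensive.
Import Order.TTheory GRing.Theory Num.Theory.
Import numFieldNormedType.Exports.

Local Open Scope classical_set_scope.
Local Open Scope ring_scope.

(** R^d is ['rV[R]_d], with the topology of the library and the sigma-algebra
    generated by the coordinates, i.e. the product (Borel) sigma-algebra, as the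
    library does for tuples. *)

Section rV_measurable.
Context {R : realType} (d : nat).

Let coord (i : 'I_d) (x : 'rV[R]_d) : measurableTypeR R := x ord0 i.

Let rV_set0 : g_sigma_preimage coord set0.
Proof. exact: sigma_algebra0. Qed.

Let rV_setC A : g_sigma_preimage coord A -> g_sigma_preimage coord (~` A).
Proof. exact: sigma_algebraC. Qed.

Let rV_bigcup (F : (set 'rV[R]_d)^nat) :
  (forall i, g_sigma_preimage coord (F i)) ->
  g_sigma_preimage coord (\bigcup_i (F i)).
Proof. exact: sigma_algebra_bigcup. Qed.

HB.instance Definition _ :=
  @isMeasurable.Build (measure_tuple_display default_measure_display)
    'rV[R]_d (g_sigma_preimage coord) rV_set0 rV_setC rV_bigcup.

Lemma measurable_rV_coord (i : 'I_d) :
  measurable_fun [set: 'rV[R]_d]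
    ((fun x => x ord0 i) : 'rV[R]_d -> measurableTypeR R).
Proof.
move=> _ Y mY; rewrite setTI; apply: sub_sigma_algebra => /=.
rewrite -bigcup_seq/=; exists i => /=; first by rewrite mem_index_enum.
by exists Y => //; rewrite setTI.
Qed.

Lemma measurable_fun_rV (d0 : measure_display) (T : measurableType d0)
    (f : T -> 'rV[R]_d) :
  (forall i, measurable_fun [set: T]
               ((fun t => f t ord0 i) : T -> measurableTypeR R)) ->
  measurable_fun [set: T] f.
Proof.
move=> mf; suff : g_sigma_preimage (fun i => coord i \o f) `<=` measurable.
  rewrite g_sigma_preimage_comp => prefS _ A mA.
  by apply: prefS; exists A.
apply: smallest_sub; first exact: sigma_algebra_measurable.
elim/big_ind : _ => //.
- by move=> A B sA sB; rewrite subUset.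
- by move=> i _ _ [B mB <-]; exact: mf.
Qed.

End rV_measurable.

Section lebesgue_rV.
Context {R : realType}.

Definition rV_cons d (z : measurableTypeR R * 'rV[R]_d) : 'rV[R]_d.+1 :=
  \row_i if unlift ord0 i is Some j then z.2 ord0 j else z.1.

Definition rV_uncons d (x : 'rV[R]_d.+1) : measurableTypeR R * 'rV[R]_d :=
  (x ord0 ord0, \row_i x ord0 (lift ord0 i)).

Lemma rV_cons0 d (z : measurableTypeR R * 'rV[R]_d) :
  rV_cons z ord0 ord0 = z.1.
Proof. by rewrite mxE unlift_none. Qed.

Lemma rV_consS d (z : measurableTypeR R * 'rV[R]_d) i :
  rV_cons z ord0 (lift ord0 i) = z.2 ord0 i.
Proof. by rewrite mxE liftK. Qed.

Lemma rV_consK d : cancel (@rV_cons d) (@rV_uncons d).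
Proof.
move=> z; rewrite /rV_uncons rV_cons0 [RHS]surjective_pairing; congr pair.
by apply/rowP => i; rewrite mxE rV_consS.
Qed.

Lemma measurable_rV_cons d : measurable_fun setT (@rV_cons d).
Proof.
apply: measurable_fun_rV => i; case: (unliftP ord0 i) => [j|] ->.
- under eq_fun do rewrite rV_consS.
  exact: (measurableT_comp (measurable_rV_coord j) measurable_snd).
- under eq_fun do rewrite rV_cons0.
  exact: measurable_fst.
Qed.

Lemma measurable_rV_uncons d : measurable_fun setT (@rV_uncons d).
Proof.
apply: measurable_fun_pair; first exact: measurable_rV_coord.
apply: measurable_fun_rV => i; under eq_fun do rewrite mxE.
exact: measurable_rV_coord.
Qed.

Section step.
Variables (d : nat) (m : {sigma_finite_measure set 'rV[R]_d -> \bar R}).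

Definition lebesgue_rVS :=
  pushforward (@lebesgue_measure R \x m)%E (@rV_cons d).

Let pushforward_cons :=
  measure_function_pushforward__canonical__measure_function_Measure
    (@lebesgue_measure R \x m)%E (@measurable_rV_cons d).

HB.instance Definition _ := isMeasure.Build _ _ _ lebesgue_rVS
  (measure0 pushforward_cons) (measure_ge0 pushforward_cons)
  (@measure_semi_sigma_additive _ _ _ pushforward_cons).

Let lebesgue_rVS_sigma_finite : sigma_finite setT lebesgue_rVS.
Proof.
have /sigma_finiteP[F [FT ndF Foo]] := sigma_finiteT (@lebesgue_measure R).
have /sigma_finiteP[G [GT ndG Goo]] := sigma_finiteT m.
exists (fun k => @rV_uncons d @^-1` (F k `*` G k)).
  apply/esym; rewrite -subTset => x _.
  have [i _ Fi] : (\bigcup_i F i) (rV_uncons x).1 by rewrite -FT.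
  have [j _ Gj] : (\bigcup_j G j) (rV_uncons x).2 by rewrite -GT.
  exists (maxn i j) => //; split.
  - by move: Fi; exact/subsetPset/ndF/leq_maxl.
  - by move: Gj; exact/subsetPset/ndG/leq_maxr.
move=> k; have [mF Fk] := Foo k; have [mG Gk] := Goo k; split.
  rewrite -[X in measurable X]setTI.
  by apply: measurable_rV_uncons => //; exact: measurableX.
rewrite /lebesgue_rVS /pushforward -comp_preimage.
rewrite (_ : @rV_uncons d \o @rV_cons d = id); last first.
  by apply/funext => z /=; rewrite rV_consK.
by rewrite preimage_id product_measure1E// lte_mul_pinfty// ge0_fin_numE.
Qed.

HB.instance Definition _ := @Measure_isSigmaFinite.Build _ _ _
  lebesgue_rVS lebesgue_rVS_sigma_finite.

End step.

(** The Lebesgue measure on R^d, as the d-fold product of [lebesgue_measure]. *)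
Fixpoint lebesgue_rV d : {sigma_finite_measure set 'rV[R]_d -> \bar R} :=
  if d is d'.+1 then lebesgue_rVS (lebesgue_rV d')
  else dirac (0 : 'rV[R]_0).

Lemma lebesgue_rV_box d (a b : 'I_d -> R) : (forall i, a i <= b i) ->
  lebesgue_rV d [set x : 'rV[R]_d | forall i, x ord0 i \in `]a i, b i]]
  = (\prod_i (b i - a i))%:E.
Proof.
elim: d a b => [|d IH] a b ab; first by rewrite big_ord0 /= diracE mem_set// => -[].
pose B := [set x : 'rV[R]_d |
             forall i, x ord0 i \in `]a (lift ord0 i), b (lift ord0 i)]].
have mB : measurable B.
  rewrite (_ : B = \big[setI/setT]_(i < d) ((fun x : 'rV[R]_d => x ord0 i)
                     @^-1` `]a (lift ord0 i), b (lift ord0 i)])).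
    apply: bigsetI_measurable => i _; rewrite -[X in measurable X]setTI.
    by apply: measurable_rV_coord => //; exact: measurable_itv.
  rewrite -bigcap_seq; apply/seteqP; split => x /= h i.
    by move=> _; exact: h.
  by apply: (h i) => /=; rewrite mem_index_enum.
rewrite /= /lebesgue_rVS /pushforward.
rewrite (_ : @rV_cons d @^-1` _ = `]a ord0, b ord0] `*` B); last first.
  apply/seteqP; split => z /=.
    move=> h; split; first by have := h ord0; rewrite rV_cons0.
    by move=> i; have := h (lift ord0 i); rewrite rV_consS.
  case=> h1 h2 i; case: (unliftP ord0 i) => [j|] ->.
    by rewrite rV_consS.
  by rewrite rV_cons0.
rewrite product_measure1E//.
rewrite [X in (X * _)%E](lebesgue_measure_itv `]a ord0, b ord0]) /= IH//.
rewrite big_ord_recl EFinM; congr (_ * _)%E; rewrite lte_fin.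
have := ab ord0; rewrite le_eqVlt => /orP[/eqP->|->//].
by rewrite ltxx subrr.
Qed.

End lebesgue_rV.

Section euclidean.
Context {R : realType} {d : nat}.
Implicit Types (u v x y : 'rV[R]_d) (U : set 'rV[R]_d).

(* The norm [`|x|] of ['rV[R]_d] is the sup-norm, hence the following. *)
Definition dotp u v : R := \sum_i u ord0 i * v ord0 i.

Definition enorm u : R := Num.sqrt (dotp u u).

Definition eball x (r : R) : set 'rV[R]_d := [set y | enorm (y - x) < r].

Definition diameter U : R := sup [set enorm (xy.1 - xy.2) | xy in U `*` U].

Definition inradius U : R :=
  sup [set r | 0 < r /\ exists x, eball x r `<=` U].

End euclidean.

(** A function on [U] is represented by any of its extensions to the whole of
    R^d: the notions below only depend on the values taken on [U]. *)

Section function_spaces.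
Context {R : realType} {d n : nat}.
Implicit Types (U : set 'rV[R]_d) (f : 'rV[R]_d -> 'rV[R]_n).

(* [mmeasure mdeg q], denoted [msize q] in mpoly, is one plus the total degree
   of [q], and 0 for [q = 0]. *)
Definition vpoly U (l : nat) : set ('rV[R]_d -> 'rV[R]_n) :=
  [set f | exists q : 'I_n -> mpoly d R,
    (forall i, mmeasure mdeg (q i) <= l.+1)%N /\
    (forall x, U x -> forall i, f x ord0 i = meval (x ord0) (q i))].

Definition Lp U (p : \bar R) : set ('rV[R]_d -> 'rV[R]_n) :=
  [set f | forall i, (fun x => f x ord0 i) \_ U \in Lfun (lebesgue_rV d) p].

Definition Lp_norm U (p : \bar R) f : \bar R :=
  Lnorm (lebesgue_rV d) p (EFin \o ((fun x => enorm (f x)) \_ U)).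

Definition is_L2_projector U (P : set ('rV[R]_d -> 'rV[R]_n))
    (Pi : ('rV[R]_d -> 'rV[R]_n) -> 'rV[R]_d -> 'rV[R]_n) : Prop :=
  forall Phi, Lp U 1%E Phi ->
    P (Pi Phi) /\
    forall Psi, P Psi ->
      \int[lebesgue_rV d]_(x in U) dotp (Pi Phi x - Phi x) (Psi x) = 0.

End function_spaces.

(* Main.v *)
(** Let [v] be the projection of [f]. Testing the orthogonality relation with [v]
    gives [int |v|^2 = int f.v <= n (sup |v|) (int |f|)], while a polynomial of
    degree at most [l] satisfies [(sup |v|)^2 <= (K / s)^d int |v|^2], where the
    supremum is over [U] and the integral over a cube of side [s], comparable to
    the diameter, inscribed in [U]. Hence [sup |v| <= n (K / s)^d int |f|], and
    Hoelder's inequality yields the bound in [L^p] for all [p] at once. The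
    inequality for polynomials is proved one variable at a time: in dimension
    one it follows from Lagrange interpolation at points where [p^2] is at most
    its average over well separated intervals, and Tonelli gives the rest. *)

Require Import Defs.
From mathcomp Require Import all_boot all_order all_algebra.
From mathcomp Require Import all_classical all_reals all_analysis.
From mathcomp Require Import measurable_realfun ess_sup_inf qpoly ring lra.
(* The notations and lemma names of mpoly clash with MathComp-Analysis. *)
From mathcomp Require Import (canonicals, coercions) mpoly.
Import Order.TTheory GRing.Theory Num.Theory.
Import numFieldNormedType.Exports.
Local Open Scope classical_set_scope.
Local Open Scope ring_scope.

Set Implicit Arguments.
Unset Strict Implicit.
Unset Printing Implicit Defensive.

(** * Polynomials in one variable: pointwise values against the mean square *)

Lemma horner_lagrange_bound (R : realFieldType) (l : nat) (p : {poly R})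
    (t : nat -> R) (x e w B : R) :
  (size p <= l.+1)%N -> 0 < w ->
  (forall i j : nat, i != j -> w <= `|t i - t j|) ->
  (forall i, (i < l.+1)%N -> `|x - t i| <= e) ->
  (forall i, (i < l.+1)%N -> `|p.[t i]| <= B) ->
  `|p.[x]| <= l.+1%:R * (e / w) ^+ l * B.
Proof.
move=> sp w0 tw xe pB.
(* The interpolation formula takes a sequence of nodes injective on all of [nat], which is why
   separation is assumed beyond index [l] as well. *)
have tinj : injective t.
  move=> i j tij; apply/eqP/negPn/negP => /tw.
  by rewrite tij subrr normr0 leNgt w0.
have e0 : 0 <= e by exact: le_trans (normr_ge0 _) (xe 0%N isT).
have B0 : 0 <= B by exact: le_trans (normr_ge0 _) (pB 0%N isT).
(* At [x], a Lagrange basis polynomial is a product of [l] quotients, each with numerator at most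
   [e] and denominator at least [w]. *)
have lagrange_bound (i : 'I_l.+1) :
    `|(tnth (l.+1.-lagrange t) i).[x]| <= (e / w) ^+ l.
  rewrite lagrangeE// hornerM hornerC !horner_prod normrM normfV !normr_prod.
  rewrite mulrC -prodf_div.
  have -> : (e / w) ^+ l = \prod_(j < l.+1 | (j : nat) != i) (e / w).
    rewrite (eq_bigl (mem (predC1 i)))// prodr_const.
    by rewrite cardC1 card_ord.
  apply: ler_prod => j ji; rewrite !hornerXsubC divr_ge0//=.
  apply: ler_pM; rewrite ?invr_ge0//.
  - exact: xe.
  - have wt : w <= `|t i - t j| by apply: tw; rewrite eq_sym.
    by rewrite lef_pV2// posrE (lt_le_trans w0).
rewrite [in leLHS](lagrange_gen (ltn0Sn l) tinj sp) horner_sum.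
apply: le_trans (ler_norm_sum _ _ _) _.
apply: (@le_trans _ _ (\sum_(i < l.+1) B * (e / w) ^+ l)).
  apply: ler_sum => i _; rewrite hornerM hornerC normrM.
  by apply: ler_pM => //; exact: pB.
by rewrite sumr_const card_ord -[leLHS]mulr_natl [B * _]mulrC mulrA.
Qed.

(** A minimum point of the square of [p] on the compact interval will do, since the integrand
    dominates its minimum. *)
Lemma exists_le_average (R : realType) (p : {poly R}) (a b : R) : a < b ->
  exists2 t, t \in `[a, b] &
    ((p.[t] ^+ 2 * (b - a))%:E <=
      \int[@lebesgue_measure R]_(y in `]a, b]) (p.[y] ^+ 2)%:E)%E.
Proof.
move=> ab.
have cp : {within `[a, b], continuous (fun y => p.[y] ^+ 2)}.
  apply: continuous_subspaceT => y; under eq_fun do rewrite -hornerXn -horner_comp.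
  exact: continuous_horner.
have [t tab tmin] := EVT_min (ltW ab) cp; exists t => //.
apply: (@le_trans _ _ (\int[@lebesgue_measure R]_(y in `]a, b])
                          cst (p.[t] ^+ 2)%:E y)%E).
  rewrite integral_cst//= lebesgue_measure_itv/= lte_fin ab.
  by rewrite -EFinB -EFinM.
apply: ge0_le_integral => //.
- by move=> y _; rewrite lee_fin sqr_ge0.
- apply/measurable_EFinP; apply: measurable_funX.
  exact: measurable_poly.
- move=> y; rewrite /= in_itv/= => /andP[ay yb]; rewrite lee_fin.
  by apply: tmin; rewrite in_itv/= (ltW ay).
Qed.

(** The square of the Lagrange factor, for nodes [s / l.*2.+1] apart and at distance at most
    [(M + 1) * s], times the [l.*2.+1] lost by averaging over intervals of length [s / l.*2.+1]. The
    factor [1 / s] is kept apart, so the constant is scale-free. *)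
Definition inverse_cst (R : realType) (l : nat) (M : R) : R :=
  (l.+1%:R * ((M + 1) * l.*2.+1%:R) ^+ l) ^+ 2 * l.*2.+1%:R.

Lemma inverse_cst_gt0 (R : realType) (l : nat) (M : R) :
  0 <= M -> 0 < inverse_cst l M.
Proof.
move=> M0; rewrite /inverse_cst mulr_gt0// exprn_gt0// mulr_gt0//.
by rewrite exprn_gt0// mulr_gt0// ltr_wpDl.
Qed.

(** Cut []a, a + s]] into [l.*2.+1] intervals of length [w] and choose one node in each interval of
    even rank: the intervals of odd rank keep the nodes at least [w] apart. *)
Lemma poly_inverse1 (R : realType) (l : nat) (p : {poly R}) (a s M x : R) :
  (size p <= l.+1)%N -> 0 < s -> 0 <= M -> `|x - a| <= M * s ->
  ((p.[x] ^+ 2)%:E <= (inverse_cst l M / s)%:E *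
     \int[@lebesgue_measure R]_(y in `]a, (a + s)%R]) (p.[y] ^+ 2)%:E)%E.
Proof.
move=> sp s0 M0 xa.
set I := (\int[_]_(y in _) _)%E.
have K0 : 0 < inverse_cst l M / s by rewrite divr_gt0// inverse_cst_gt0.
have I0 : (0 <= I)%E by apply: integral_ge0 => y _; rewrite lee_fin sqr_ge0.
(* Treating an infinite integral apart spares a proof of integrability. *)
have [->|Ioo] := eqVneq I +oo%E; first by rewrite gt0_muley ?leey// lte_fin.
have Ifin : I \is a fin_num by rewrite ge0_fin_numE// ltey.
pose w := s / l.*2.+1%:R.
have w0 : 0 < w by rewrite divr_gt0.
have wE : s = w * l.*2.+1%:R by rewrite divfK.
(* Nodes exist for every [i], as the interpolation sequence requires, but only for [i <= l] does the
   interval lie within [[a, a + s]], so that its integral is at most [I]. *)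
have node (i : nat) : exists t, t \in `[a + i.*2%:R * w, a + i.*2.+1%:R * w] /\
    ((i < l.+1)%N -> p.[t] ^+ 2 * w <= fine I).
  have wi : i.*2.+1%:R * w = i.*2%:R * w + w by rewrite -addn1 natrD mulrDl mul1r.
  have ab : a + i.*2%:R * w < a + i.*2.+1%:R * w by rewrite ltrD2l wi ltrDl.
  have [t tab tI] := exists_le_average p ab; exists t; split => // il.
  rewrite -lee_fin fineK//; apply: le_trans (le_trans tI _).
    by rewrite lee_fin wi addrA [X in X - _]addrC addrK.
  apply: ge0_subset_integral => //.
  - apply/measurable_EFinP; apply: measurable_funX.
    exact: measurable_poly.
  - by move=> y _; rewrite lee_fin sqr_ge0.
  - move=> y; rewrite /= !in_itv/= => /andP[ay yb]; apply/andP; split.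
      apply: le_lt_trans ay; rewrite lerDl mulr_ge0// ltW//.
    apply: (le_trans yb); rewrite lerD2l wE mulrC ler_pM2l// ler_nat ltnS.
    by rewrite leq_double -ltnS.
have [t tP] := choice node.
have sep i j : (i < j)%N -> w <= `|t i - t j|.
  move=> ij; have [ti _] := tP i; have [tj _] := tP j.
  move: ti tj; rewrite !in_itv/= => /andP[_ ti] /andP[tj _].
  have ijw : i.*2.+1%:R * w + w <= j.*2%:R * w.
    rewrite -[X in _ + X]mul1r -mulrDl ler_pM2r// natr1 ler_nat.
    by rewrite -doubleS leq_double.
  rewrite distrC ger0_norm; lra.
pose B := Num.sqrt (fine I / w).
have J0 : 0 <= fine I / w by rewrite divr_ge0 ?fine_ge0// ltW.
have pB i : (i < l.+1)%N -> `|p.[t i]| <= B.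
  move=> il; have [_ /(_ il) h] := tP i.
  by rewrite -sqrtr_sqr ler_sqrt// ler_pdivlMr.
have xt i : (i < l.+1)%N -> `|x - t i| <= (M + 1) * s.
  move=> il; have [ti _] := tP i; rewrite -(subrKA a x (- t i)).
  apply: (le_trans (ler_normD _ _)); rewrite mulrDl mul1r lerD//.
  move: ti; rewrite in_itv/= => /andP[ati tia].
  have ia : 0 <= i.*2%:R * w by rewrite mulr_ge0// ltW.
  have is_ : i.*2.+1%:R * w <= s.
    by rewrite wE mulrC ler_pM2l// ler_nat ltnS leq_double -ltnS.
  rewrite distrC ger0_norm; lra.
have tsep (i j : nat) : i != j -> w <= `|t i - t j|.
  by rewrite neq_ltn => /orP[|]/sep//; rewrite distrC.
have := horner_lagrange_bound sp w0 tsep xt pB.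
have -> : (M + 1) * s / w = (M + 1) * l.*2.+1%:R.
  rewrite wE; field; rewrite (gt_eqF w0)//=.
move=> pxB.
rewrite -(fineK Ifin) -EFinM lee_fin.
rewrite -real_normK ?num_real//.
apply: le_trans (_ : (l.+1%:R * ((M + 1) * l.*2.+1%:R) ^+ l * B) ^+ 2 <= _).
  by rewrite lerXn2r// nnegrE (le_trans _ pxB).
rewrite exprMn sqr_sqrtr// /inverse_cst wE.
rewrite le_eqVlt; apply/orP; left; apply/eqP.
by field; rewrite nat1r pnatr_eq0 (gt_eqF w0).
Qed.

(** * The inverse inequality in several variables *)

Definition box_indic (R : realType) d (a : 'rV[R]_d) (s : R) (y : 'rV[R]_d) : R :=
  \prod_i \1_(`]a ord0 i, a ord0 i + s]) (y ord0 i).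

Lemma box_indic_ge0 (R : realType) d (a : 'rV[R]_d) s y : 0 <= box_indic a s y.
Proof. by apply: prodr_ge0. Qed.

Lemma measurable_box_indic (R : realType) d (a : 'rV[R]_d) (s : R) :
  measurable_fun setT (box_indic a s).
Proof.
apply: measurable_prod => i _.
apply: (measurableT_comp _ (measurable_rV_coord i)).
exact: measurable_indic.
Qed.

(** Freezing the first coordinate preserves this property, which makes it suitable for induction on
    the dimension; a bound on the total degree implies it. *)
Definition separately_poly (R : realType) d l (f : 'rV[R]_d -> R) :=
  forall i (x : 'rV[R]_d), exists2 p : {poly R}, (size p <= l.+1)%N &
    forall t, f (\row_j (if j == i then t else x ord0 j)) = p.[t].

Lemma separately_poly_cons (R : realType) d l (f : 'rV[R]_d.+1 -> R) z :
  separately_poly l f -> separately_poly l (fun y => f (rV_cons (z, y))).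
Proof.
move=> fl i x; have [p sp pE] := fl (lift ord0 i) (rV_cons (z, x)).
exists p => // t; rewrite -pE; congr f; apply/rowP => j; rewrite !mxE.
case: (unliftP ord0 j) => [k ->|->].
  by rewrite /= !mxE (inj_eq lift_inj).
by rewrite (negbTE (neq_lift _ _)).
Qed.

Lemma measurable_consr (R : realType) d (f : 'rV[R]_d.+1 -> R) z :
  measurable_fun setT f -> measurable_fun setT (fun y => f (rV_cons (z, y))).
Proof.
move=> mf; apply: (measurableT_comp mf).
exact: (measurableT_comp (@measurable_rV_cons R d) (measurable_pair1 z)).
Qed.

(** The measure on the left is the image of a product measure under [rV_cons], so this is Tonelli's
    theorem after transport. *)
Lemma integral_lebesgue_rVS (R : realType) d (f : 'rV[R]_d.+1 -> \bar R) :
  measurable_fun setT f -> (forall x, 0 <= f x)%E ->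
  (\int[lebesgue_rV d.+1]_x f x =
   \int[@lebesgue_measure R]_z \int[lebesgue_rV d]_y f (rV_cons (z, y)))%E.
Proof.
move=> mf f0.
have := @ge0_integral_pushforward _ _ _ _ R _ (@measurable_rV_cons R d)
  (@lebesgue_measure R \x lebesgue_rV d)%E setT f measurableT mf (fun y _ => f0 y).
rewrite /= preimage_setT => ->.
rewrite (@fubini_tonelli1 _ _ _ _ R (@lebesgue_measure R) (lebesgue_rV d))//.
exact: (measurableT_comp mf (@measurable_rV_cons R d)).
Qed.

(** Induction on [d]: the one-variable inequality is applied in the first coordinate with the others
    frozen at [x], then the induction hypothesis bounds the integrand for each value [z] of the
    first coordinate. Each variable costs one factor [inverse_cst l M / s]. *)
Lemma separately_poly_inverse (R : realType) d l (f : 'rV[R]_d -> R)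
    (a x : 'rV[R]_d) (s M : R) :
  measurable_fun setT f -> separately_poly l f -> 0 < s -> 0 <= M ->
  (forall i, `|x ord0 i - a ord0 i| <= M * s) ->
  ((f x ^+ 2)%:E <= ((inverse_cst l M / s) ^+ d)%:E *
     \int[lebesgue_rV d]_y (f y ^+ 2 * box_indic a s y)%:E)%E.
Proof.
move=> mf fl s0 M0; set k := inverse_cst l M / s.
have k0 : 0 < k by rewrite divr_gt0// inverse_cst_gt0.
elim: d f a x mf fl => [|d IH] f a x mf fl xa.
  (* In dimension 0 the measure is the Dirac mass at the only point and the empty product is 1, so
     both sides agree. *)
  have -> : x = 0 by apply/rowP; case.
  rewrite expr0 mul1e /= integral_dirac//; last first.
    apply/measurable_EFinP; apply: measurable_funM.
      exact: measurable_funX.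
    exact: measurable_box_indic.
  by rewrite diracT mul1e /box_indic big_ord0 mulr1.
have [p sp pE] := fl ord0 x.
pose x' : 'rV[R]_d := \row_i x ord0 (lift ord0 i).
pose a' : 'rV[R]_d := \row_i a ord0 (lift ord0 i).
have fE t : f (rV_cons (t, x')) = p.[t].
  rewrite -pE; congr f; apply/rowP => j; rewrite !mxE.
  by case: (unliftP ord0 j) => [i|] ->; rewrite //= mxE.
have xE : f x = p.[x ord0 ord0].
  rewrite -pE; congr f; apply/rowP => j; rewrite !mxE.
  by case: eqP => [->|].
pose G (z : measurableTypeR R * 'rV[R]_d) : \bar R :=
  (f (rV_cons z) ^+ 2 * box_indic a' s z.2)%:E.
have G0 z : (0 <= G z)%E by rewrite lee_fin mulr_ge0 ?sqr_ge0 ?box_indic_ge0.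
have mG : measurable_fun setT G.
  apply/measurable_EFinP; apply: measurable_funM.
    apply: measurable_funX.
    exact: (measurableT_comp mf (@measurable_rV_cons R d)).
  exact: (measurableT_comp (@measurable_box_indic R d a' s) measurable_snd).
have mIG : measurable_fun setT (fun z => \int[lebesgue_rV d]_y G (z, y))%E.
  exact: (measurable_fun_fubini_tonelli_F _ mG).
have IG0 z : (0 <= \int[lebesgue_rV d]_y G (z, y))%E by exact: integral_ge0.
rewrite integral_lebesgue_rVS; last 2 first.
- apply/measurable_EFinP; apply: measurable_funM.
    exact: measurable_funX.
  exact: measurable_box_indic.
- by move=> z; rewrite lee_fin mulr_ge0 ?sqr_ge0 ?box_indic_ge0.
(* The first factor of [box_indic] becomes the domain of the outer integral. *)
rewrite [X in (_ <= _ * X)%E](_ : _ =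
    \int[@lebesgue_measure R]_(z in `]a ord0 ord0, (a ord0 ord0 + s)%R])
      \int[lebesgue_rV d]_y G (z, y))%E; last first.
  rewrite [RHS]integral_mkcond; apply: eq_integral => z _.
  rewrite patchE; case: ifPn => za.
    apply: eq_integral => y _; congr (_ * _)%:E.
    rewrite /box_indic big_ord_recl rV_cons0/= indicE za mul1r.
    by apply: eq_bigr => i _; rewrite rV_consS mxE.
  rewrite integral0_eq// => y _.
  by rewrite /box_indic big_ord_recl rV_cons0/= indicE (negbTE za) mul0r mulr0.
rewrite xE; apply: (le_trans (poly_inverse1 sp s0 M0 (xa ord0))).
rewrite [k ^+ _]exprS [(k * _)%:E]EFinM -muleA lee_pmul2l//.
rewrite -ge0_integralZl//; last 2 first.
- exact: measurable_funTS.
- by rewrite lee_fin exprn_ge0// ltW.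
apply: ge0_le_integral => //.
- by move=> z _; rewrite lee_fin sqr_ge0.
- apply/measurable_EFinP; apply: measurable_funX.
  exact: measurable_poly.
- by apply: measurable_funTS; exact: measurable_funeM.
move=> z _; rewrite -fE; apply: IH.
- exact: measurable_consr.
- exact: separately_poly_cons.
- by move=> i; rewrite !mxE; exact: xa.
Qed.

(** * Evaluation of multivariate polynomials *)

Section mpoly_functions.
Context {R : realType} {d : nat}.
Implicit Types q : mpoly.mpoly d R.

Lemma measurable_meval q :
  measurable_fun setT (fun x : 'rV[R]_d => mpoly.meval (x ord0) q).
Proof.
under eq_fun do rewrite mpoly.mevalE.
apply: measurable_sum => m; apply: measurable_funM => //.
apply: measurable_prod => i _; apply: measurable_funX.
exact: measurable_rV_coord.
Qed.

Lemma meval_separately_poly l q : (mpoly.mmeasure mpoly.mdeg q <= l.+1)%N ->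
  separately_poly l (fun x : 'rV[R]_d => mpoly.meval (x ord0) q).
Proof.
move=> ql i x.
exists (\sum_(m <- mpoly.msupp q)
  (mpoly.mcoeff m q * \prod_(j < d | j != i) x ord0 j ^+ mpoly.fun_of_multinom m j)
    *: 'X^(mpoly.fun_of_multinom m i)).
  rewrite big_seq; apply: (big_ind (fun p : {poly R} => (size p <= l.+1)%N)).
  - by rewrite size_poly0.
  - move=> p1 p2 h1 h2; apply: leq_trans (size_polyD _ _) _.
    by rewrite geq_max h1.
  - move=> m mq; apply: leq_trans (size_scale_leq _ _) _; rewrite size_polyXn.
    apply: leq_trans ql; apply: leq_ltn_trans (mpoly.msize_mdeg_lt mq).
    by rewrite mpoly.mdegE (bigD1 i)//= leq_addr.
move=> t; rewrite mpoly.mevalE horner_sum; apply: eq_bigr => m _.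
rewrite hornerZ hornerXn -mulrA; congr (_ * _).
rewrite (bigD1 i)//= mxE eqxx mulrC; congr (_ * _).
by apply: eq_bigr => j /negbTE ji; rewrite mxE ji.
Qed.

Lemma meval_bounded q (B : R) : exists c : R,
  forall x : 'rV[R]_d, (forall i, `|x ord0 i| <= B) -> `|mpoly.meval (x ord0) q| <= c.
Proof.
exists (\sum_(m <- mpoly.msupp q)
  `|mpoly.mcoeff m q| * \prod_(j < d) B ^+ mpoly.fun_of_multinom m j) => x xB.
rewrite mpoly.mevalE; apply: le_trans (ler_norm_sum _ _ _) _.
apply: ler_sum => m _; rewrite normrM ler_wpM2l// normr_prod.
apply: ler_prod => i _; rewrite normr_ge0/= normrX lerXn2r ?nnegrE//.
exact: le_trans (normr_ge0 _) (xB i).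
Qed.

End mpoly_functions.

(** * Euclidean norm, cubes, diameter and inradius *)

Section geometry.
Context {R : realType} {d : nat}.
Implicit Types (U : set 'rV[R]_d) (x y a : 'rV[R]_d).

Lemma dotp_ge0 x : 0 <= dotp x x.
Proof. by apply: sumr_ge0 => i _; rewrite -expr2 sqr_ge0. Qed.

Lemma sqr_enorm x : enorm x ^+ 2 = dotp x x.
Proof. by rewrite sqr_sqrtr// dotp_ge0. Qed.

Lemma coord_le_enorm x i : `|x ord0 i| <= enorm x.
Proof.
rewrite -sqrtr_sqr ler_sqrt ?dotp_ge0// /dotp (bigD1 i)//= -expr2 lerDl.
by apply: sumr_ge0 => j _; rewrite -expr2 sqr_ge0.
Qed.

Lemma dotp_le x y : `|dotp x y| <= \sum_i `|x ord0 i| * enorm y.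
Proof.
apply: le_trans (ler_norm_sum _ _ _) _; apply: ler_sum => i _.
by rewrite normrM ler_wpM2l// coord_le_enorm.
Qed.

Definition box a (s : R) : set 'rV[R]_d :=
  [set x | forall i, x ord0 i \in `]a ord0 i, a ord0 i + s]].

Lemma measurable_box a s : measurable (box a s).
Proof.
rewrite (_ : box a s = \big[setI/setT]_(i < d)
    ((fun x : 'rV[R]_d => x ord0 i) @^-1` `]a ord0 i, a ord0 i + s])).
  apply: bigsetI_measurable => i _; rewrite -[X in measurable X]setTI.
  exact: measurable_rV_coord.
by rewrite -bigcap_seq; apply/seteqP; split => x /= h i;
  [move=> _; exact: h | apply: (h i); rewrite /= mem_index_enum].
Qed.

Lemma lebesgue_box a s : 0 <= s -> lebesgue_rV d (box a s) = (s ^+ d)%:E.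
Proof.
move=> s0; rewrite /box (@lebesgue_rV_box R d _ (fun i => a ord0 i + s)).
  by under eq_bigr do rewrite addrC addKr; rewrite prodr_const card_ord.
by move=> i; rewrite lerDl.
Qed.

Lemma box_indicE a s y : box_indic a s y = \1_(box a s) y.
Proof.
rewrite /box_indic indicE; have [yB|yB] := boolP (y \in box a s).
  rewrite big1// => i _; rewrite indicE mem_set//=.
  by move: yB; rewrite inE; exact.
have [i yi] : exists i, y ord0 i \notin `]a ord0 i, a ord0 i + s].
  apply/existsP; rewrite -negb_forall; apply: contra yB => /forallP yB.
  by rewrite inE.
rewrite (bigD1 i)//= indicE mem_setE (negbTE yi) mul0r//.
Qed.

(** The sigma-algebra is generated by the coordinates, so an open set has to be written as a
    countable union of boxes, here with rational centres and half-sides [1 / k.+1]. *)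
Lemma open_rV_measurable U : open U -> measurable U.
Proof.
rewrite openE => oU.
pose F (ck : 'rV[rat]_d * nat) : set 'rV[R]_d :=
  let e := ck.2.+1%:R^-1 in let b := box (\row_i (ratr (ck.1 ord0 i) - e)) (e + e) in
  if `[< b `<=` U >] then b else set0.
rewrite (_ : U = \bigcup_ck F ck).
  apply: countable_bigcupT_measurable => // ck; rewrite /F.
  by case: ifP => // _; exact: measurable_box.
apply/seteqP; split => [x Ux|x [ck _]]; last first.
  by rewrite /F; case: ifPn => // /asboolP; exact.
have /nbhs_ballP[e /= e0 xeU] := oU x Ux.
(* A box of half-side below [e / 2] that contains [x] stays within sup-distance [e] of [x]. *)
have [k ke] : exists k : nat, k.+1%:R^-1 < e / 2.
  by have [k] := ltr_add_invr (divr_gt0 e0 (ltr0n _ 2)); rewrite add0r; exists k.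
set f := k.+1%:R^-1 in ke.
have f0 : 0 < f by rewrite invr_gt0.
have /choice[c cP] : forall i, exists c : rat, ratr c \in `]x ord0 i - f, x ord0 i + f[.
  move=> i; have xf : x ord0 i - f < x ord0 i + f by lra.
  exact: rat_in_itvoo xf.
have bE : F (\row_i c i, k) = box (\row_i (ratr (c i) - f)) (f + f).
  rewrite /F/= -/f (_ : \row_i _ = \row_i (ratr (c i) - f)).
    case: ifPn => // /asboolP[] y yb; apply: xeU; split => // i j.
    rewrite /ball/= ord1; move: (yb j) (cP j); rewrite mxE !in_itv/=.
    move=> /andP[? ?] /andP[? ?]; rewrite ltr_norml; apply/andP; split; lra.
  by apply/rowP => i; rewrite !mxE.
exists (\row_i c i, k) => //; rewrite bE => i; rewrite mxE in_itv/=.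
have := cP i; rewrite in_itv/= => /andP[? ?]; apply/andP; split; lra.
Qed.

Lemma sqr_enorm_le x (B : R) : 0 <= B -> (forall i, `|x ord0 i| <= B) ->
  enorm x ^+ 2 <= d%:R * B ^+ 2.
Proof.
move=> B0 xB; rewrite sqr_enorm /dotp.
apply: (@le_trans _ _ (\sum_(i < d) B ^+ 2)).
  apply: ler_sum => i _; rewrite -expr2 -real_normK ?num_real//.
  by rewrite lerXn2r ?nnegrE.
by rewrite sumr_const card_ord -[leLHS]mulr_natl.
Qed.

Lemma bounded_coord U : bounded_set U ->
  exists2 B : R, 0 <= B & forall x, U x -> forall i, `|x ord0 i| <= B.
Proof.
move=> [M [Mr UM]]; exists (`|M| + 1); first by rewrite addr_ge0.
move=> x Ux i; apply: (@le_trans _ _ `|x|).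
  rewrite [leRHS]/Num.Def.normr/= mx_normrE.
  exact: (le_bigmax _ (fun ij => `|x ij.1 ij.2|) (ord0, i)).
by apply: UM => //; rewrite (le_lt_trans (ler_norm _))// ltrDl.
Qed.

(** [sup] is a least upper bound only for sets bounded above, hence the boundedness of [U]. *)
Lemma enorm_le_diameter U x y : bounded_set U -> U x -> U y ->
  enorm (x - y) <= diameter U.
Proof.
move=> /bounded_coord[B B0 UB] Ux Uy; apply: ub_le_sup; last by exists (x, y).
(* A crude bound that avoids roots: [e <= 1 + e ^+ 2] for every real [e]. *)
exists (1 + d%:R * (B + B) ^+ 2) => _ [[u v] [/= Uu Uv] <-].
have := @sqr_enorm_le (u - v) (B + B).
have e0 : 0 <= enorm (u - v) by exact: sqrtr_ge0.
have BB : 0 <= B + B by exact: addr_ge0.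
move=> /(_ BB) h.
have {h} : enorm (u - v) ^+ 2 <= d%:R * (B + B) ^+ 2.
  apply: h => i; rewrite !mxE; apply: (le_trans (ler_normB _ _)).
  by rewrite lerD ?UB.
nra.
Qed.

Lemma eball_center x (r : R) : 0 < r -> eball x r x.
Proof.
move=> r0; rewrite /eball/= /enorm /dotp big1 ?sqrtr0// => i _.
by rewrite !mxE subrr mul0r.
Qed.

(** The factor 1/2 yields a radius strictly below the supremum. Degenerate cases contradict
    [0 < delta]: the supremum of the empty set and the inverse of 0 are both 0. *)
Lemma inner_ball U (delta : R) : bounded_set U -> 0 < delta ->
  delta <= inradius U / diameter U ->
  exists x r, [/\ 0 < r, eball x r `<=` U, 0 < diameter U &
                  delta * diameter U / 2 < r].
Proof.
move=> bU delta0; rewrite /inradius; set S := [set r | _] => dS.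
have [S0|/set0P S0] := eqVneq S set0.
  by move: dS; rewrite S0 sup0 mul0r leNgt delta0.
have D0 : 0 < diameter U.
  case: (S0) => r [r0 [x xrU]].
  have Ux : U x by apply: xrU; exact: eball_center.
  rewrite lt_neqAle; apply/andP; split.
    by apply: contraTneq dS => <-; rewrite invr0 mulr0 -ltNge.
  by apply: le_trans (enorm_le_diameter bU Ux Ux); exact: sqrtr_ge0.
have : delta * diameter U / 2 < sup S.
  apply: (@lt_le_trans _ _ (delta * diameter U)).
    by rewrite ltr_pdivrMr// ltr_pMr ?mulr_gt0// ltr1n.
  by rewrite -ler_pdivlMr.
by move=> /(sup_gt S0)[r [r0 [x xrU]] dr]; exists x, r.
Qed.

(** The point [x] is the lower corner of the cube. The divisor [d.+1] replaces the square root of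
    [d], since [d * s ^+ 2 < (d.+1 * s) ^+ 2]. *)
Lemma box_sub_eball x (r : R) : 0 < r -> box x (r / d.+1%:R) `<=` eball x r.
Proof.
move=> r0 y yb; rewrite /eball/=; set s := r / d.+1%:R in yb.
have s0 : 0 < s by rewrite divr_gt0.
have h : enorm (y - x) ^+ 2 <= d%:R * s ^+ 2.
  apply: sqr_enorm_le => [|i]; first exact: ltW.
  have := yb i; rewrite in_itv/= !mxE => /andP[? ?].
  by rewrite ger0_norm; lra.
rewrite -(@ltr_pXn2r _ 2)// ?nnegrE ?sqrtr_ge0 ?(ltW r0)//.
apply: (le_lt_trans h).
have -> : r = s * d.+1%:R by rewrite divfK.
rewrite [(s * _) ^+ 2]exprMn [ltLHS]mulrC ltr_pM2l ?exprn_gt0// -natrX ltr_nat.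
by rewrite -mulnn mulSn addSn ltnS leq_addr.
Qed.

(** Half-side [2 * diameter U] instead of [diameter U] gives the strict inequality at the open
    faces. *)
Lemma sub_box U x : bounded_set U -> U x -> 0 < diameter U ->
  U `<=` box (\row_i (x ord0 i - 2 * diameter U)) (4 * diameter U).
Proof.
move=> bU Ux D0 y Uy i; have := enorm_le_diameter bU Uy Ux.
move=> /(le_trans (coord_le_enorm _ i)); rewrite !mxE ler_norml in_itv/=.
by move=> /andP[? ?]; apply/andP; split; lra.
Qed.

End geometry.

(** * Norms of functions that vanish outside a set of finite measure *)

Section Lnorm_support.
Context {disp : measure_display} {T : measurableType disp} {R : realType}.
Variables (mu : {measure set T -> \bar R}) (A : set T) (m : R).
Hypotheses (mA : measurable A) (muA : mu A = m%:E).
Implicit Types (f g : T -> R) (p : \bar R).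

(** The exponent [(fine p)^-1] also covers [p = +oo]: [fine +oo] is 0, its inverse is 0, and the
    power is then 1. *)
Lemma Lnorm_le_cst g (c : R) p : (1 <= p)%E -> measurable_fun setT g -> 0 <= c ->
  (forall x, ~ A x -> g x = 0) -> (\forall x \ae mu, `|g x| <= c) ->
  ('N[mu]_p[EFin \o g] <= (c * m `^ (fine p)^-1)%:E)%E.
Proof.
move=> p1 mg c0 gA gc.
have m0 : 0 <= m by rewrite -lee_fin -muA.
case: p p1 => [r| |]//; last first.
  move=> _; rewrite invr0 powRr0 mulr1 unlock; case: ifPn => // _.
  by apply/ess_supP; apply: filterS gc => x gx; rewrite /= lee_fin.
rewrite lee_fin => r1; have r0 : 0 < r by exact: lt_le_trans r1.
have rN0 : r != 0 by rewrite gt_eqF.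
have -> : (c * m `^ r^-1)%:E = (((c `^ r * m)%:E) `^ r^-1)%E.
  by rewrite poweR_EFin powRM ?powR_ge0// -powRrM divff// powRr1.
have cmE : (c `^ r * m)%:E = (\int[mu]_x ((c `^ r)%:E * (\1_A x)%:E))%E.
  rewrite ge0_integralZl//; last 2 first.
  - exact/measurable_EFinP/measurable_indic.
  - by rewrite lee_fin powR_ge0.
  by rewrite integral_indic// setIT muA EFinM.
rewrite unlock; apply: gt0_ler_poweR; rewrite ?invr_ge0 ?(ltW r0)//.
- by rewrite in_itv/= leey andbT; apply: integral_ge0 => x _; rewrite lee_fin powR_ge0.
- by rewrite in_itv/= leey andbT lee_fin mulr_ge0 ?powR_ge0.
rewrite cmE /=; apply: ae_ge0_le_integral => //.
- apply/measurable_EFinP.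
  apply/(@measurableT_comp _ _ _ _ _ _ (fun x : R => x `^ r)) => //.
  exact/measurableT_comp.
- by move=> x _; rewrite -EFinM lee_fin mulr_ge0 ?powR_ge0.
- apply/measurable_EFinP; apply: measurable_funM => //; exact: measurable_indic.
apply: filterS gc => x gx _; rewrite /= -EFinM lee_fin indicE.
have [xA|xA] := boolP (x \in A).
  by rewrite mulr1 ge0_ler_powR ?nnegrE// ltW.
by rewrite mulr0 gA ?normr0 ?powR0//; move/negP: xA; rewrite inE.
Qed.

(** Hoelder's inequality for [f] and the indicator of [A], multiplied by the power of [m] that
    appears in [Lnorm_le_cst], so that the two estimates chain without a case analysis on [p]. *)
Lemma Lnorm1_le f p : (1 <= p)%E -> 0 < m -> measurable_fun setT f ->
  (forall x, ~ A x -> f x = 0) ->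
  ('N[mu]_1[EFin \o f] * (m `^ (fine p)^-1)%:E <= m%:E * 'N[mu]_p[EFin \o f])%E.
Proof.
move=> p1 m0 mf fA; case: p p1 => [r| |]//; last first.
  move=> _; rewrite invr0 powRr0 mule1.
  have [->|Noo] := eqVneq 'N[mu]_+oo[EFin \o f]%E +oo%E.
    by rewrite gt0_muley ?lte_fin// leey.
  have Nfin : 'N[mu]_+oo[EFin \o f]%E \is a fin_num.
    by rewrite ge0_fin_numE ?ltey// Lnorm_ge0.
  have muT : (0 < mu setT)%E.
    apply: (@lt_le_trans _ _ (mu A)); first by rewrite muA lte_fin.
    by rewrite le_measure ?inE.
  (* For [p = +oo], [f] is almost everywhere bounded by its norm, so the previous estimate applies
     with exponent 1. *)
  have := @Lnorm_le_cst f (fine 'N[mu]_+oo[EFin \o f]%E) 1 (lexx _) mf.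
  rewrite invr1 powRr1 ?(ltW m0)// EFinM fineK// muleC; apply => //.
    by rewrite fine_ge0// Lnorm_ge0.
  have : \forall x \ae mu, (`|(f x)%:E| <= 'N[mu]_+oo[EFin \o f])%E.
    by rewrite unlock muT; exact: ess_sup_ge.
  by apply: filterS => x; rewrite -{1}(fineK Nfin).
rewrite lee_fin le_eqVlt => /predU1P[<-|r1].
  by rewrite invr1 powRr1 ?(ltW m0)// muleC.
have r0 : 0 < r by exact: lt_trans r1.
pose q := (1 - r^-1)^-1.
have q0 : 0 < q by rewrite invr_gt0 subr_gt0 invf_lt1.
have rq : r^-1 + q^-1 = 1 by rewrite /q invrK subrKC.
have m1A : measurable_fun setT (\1_A : T -> R) by exact: measurable_indic.
have q1 : (1 <= q%:E)%E.
  rewrite lee_fin /q invf_ge1 ?subr_gt0 ?invf_lt1//.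
  by rewrite gerBl invr_ge0 ltW.
have NA : ('N[mu]_q%:E[EFin \o \1_A] <= (m `^ q^-1)%:E)%E.
  rewrite -[X in (_ <= X%:E)%E]mul1r; apply: (@Lnorm_le_cst _ 1 q%:E) => //.
    by move=> x Ax; rewrite indicE memNset.
  by apply/nearW => x; rewrite indicE ger0_norm ?lern1 ?leq_b1.
have := hoelder mu mf m1A r0 q0 rq.
rewrite (@eq_Lnorm _ _ _ _ _ (EFin \o (f \* \1_A)%R) (EFin \o f)); last first.
  move=> x /=; rewrite indicE; have [xA|/negP xA] := boolP (x \in A).
    by rewrite mulr1.
  by rewrite mulr0 fA// => Ax; apply: xA; rewrite inE.
move=> h.
apply: (@le_trans _ _ ('N[mu]_r%:E[EFin \o f] * (m `^ q^-1)%:E * (m `^ r^-1)%:E)%E).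
  apply: lee_wpmul2r; first by rewrite lee_fin powR_ge0.
  by apply: (le_trans h); apply: lee_wpmul2l; rewrite ?Lnorm_ge0.
by rewrite -muleA -EFinM -powRD ?[q^-1 + _]addrC ?rq ?oner_eq0// powRr1 ?(ltW m0)// muleC.
Qed.

End Lnorm_support.

(** * From orthogonality to a uniform bound *)

Section orthogonality.
Context {disp : measure_display} {T : measurableType disp} {R : realType} {n : nat}.
Variables (mu : {measure set T -> \bar R}) (U : set T).
Hypothesis mU : measurable U.
Implicit Types (f g v : T -> 'rV[R]_n).

Lemma dotpBl (x y z : 'rV[R]_n) : dotp (x - y) z = dotp x z - dotp y z.
Proof. by rewrite /dotp -sumrB; apply: eq_bigr => i _; rewrite !mxE mulrBl. Qed.

(** A coordinatewise form of Cauchy-Schwarz; its factor [n] is the one in the final constant. *)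
Lemma dotp_le_enorm (x y : 'rV[R]_n) : `|dotp x y| <= n%:R * (enorm x * enorm y).
Proof.
apply: le_trans (dotp_le _ _) _.
apply: (@le_trans _ _ (\sum_(i < n) enorm x * enorm y)).
  by apply: ler_sum => i _; rewrite ler_wpM2r ?sqrtr_ge0// coord_le_enorm.
by rewrite sumr_const card_ord -[leLHS]mulr_natl.
Qed.

Lemma measurable_dotp f g :
  (forall i, measurable_fun U (fun x => f x ord0 i)) ->
  (forall i, measurable_fun U (fun x => g x ord0 i)) ->
  measurable_fun U (fun x => dotp (f x) (g x)).
Proof. by move=> mf mg; apply: measurable_sum => i; exact: measurable_funM. Qed.

Lemma measurable_enorm f : (forall i, measurable_fun U (fun x => f x ord0 i)) ->
  measurable_fun U (fun x => enorm (f x)).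
Proof.
move=> mf; apply: (@measurableT_comp _ _ _ _ _ _ (@Num.sqrt R)).
  by apply: continuous_measurable_fun; exact: sqrt_continuous.
exact: measurable_dotp.
Qed.

Lemma enorm_le_sum_norm (x : 'rV[R]_n) : enorm x <= \sum_i `|x ord0 i|.
Proof.
have [->|x0] := eqVneq (enorm x) 0; first exact: sumr_ge0.
have xp : 0 < enorm x by rewrite lt_neqAle eq_sym x0 sqrtr_ge0.
rewrite -(ler_pM2r xp) -expr2 sqr_enorm mulr_suml.
exact: le_trans (ler_norm _) (dotp_le _ _).
Qed.

Lemma integrable_enorm f :
  (forall i, mu.-integrable U (fun x => (f x ord0 i)%:E)) ->
  mu.-integrable U (fun x => (enorm (f x))%:E).
Proof.
move=> fi.
have mf i : measurable_fun U (fun x => f x ord0 i).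
  by apply/measurable_EFinP; exact: measurable_int (fi i).
have : mu.-integrable U (fun x => \sum_i `|(f x ord0 i)%:E|)%E.
  by apply: integrable_sum => // i _; exact: integrable_abse.
apply: le_integrable => //; first exact/measurable_EFinP/measurable_enorm.
move=> x _; under eq_bigr do rewrite abse_EFin.
rewrite sumEFin !abse_EFin lee_fin ger0_norm ?sqrtr_ge0//.
by rewrite (le_trans (enorm_le_sum_norm _))// ler_norm.
Qed.

Lemma orthogonal_sup_bound f v (k : R) : 0 <= k -> (mu U < +oo)%E ->
  (forall i, mu.-integrable U (fun x => (f x ord0 i)%:E)) ->
  (forall i, measurable_fun U (fun x => v x ord0 i)) ->
  (forall x, U x -> enorm (v x) ^+ 2 <= k * \int[mu]_(y in U) dotp (v y) (v y)) ->
  \int[mu]_(x in U) dotp (v x - f x) (v x) = 0 ->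
  forall x, U x -> enorm (v x) <= n%:R * k * \int[mu]_(y in U) enorm (f y).
Proof.
move=> k0 Uoo fi mv vk orth.
set I := \int[mu]_(y in U) dotp (v y) (v y) in vk.
set N := \int[mu]_(y in U) enorm (f y).
have I0 : 0 <= I by apply: Rintegral_ge0 => x _; exact: dotp_ge0.
have N0 : 0 <= N by apply: Rintegral_ge0 => x _; exact: sqrtr_ge0.
(* [S] stands in for the supremum of [enorm (v x)]. The aim is [S * S <= n * k * N * S], to be
   divided by [S]. *)
pose S := Num.sqrt (k * I).
have S0 : 0 <= S by exact: sqrtr_ge0.
have vS x : U x -> enorm (v x) <= S.
  move=> Ux; rewrite -(@ler_pXn2r _ 2)// ?nnegrE ?sqrtr_ge0//.
  by rewrite [S ^+ 2]sqr_sqrtr ?mulr_ge0// vk.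
have mf i : measurable_fun U (fun x => f x ord0 i).
  by apply/measurable_EFinP; exact: measurable_int (fi i).
have fint := integrable_enorm fi.
have Sfint : mu.-integrable U (fun x => (n%:R * S * enorm (f x))%:E).
  by under eq_fun do rewrite EFinM; exact: integrableZl.
have fvS x : U x -> `|dotp (f x) (v x)| <= n%:R * S * enorm (f x).
  move=> Ux; apply: le_trans (dotp_le_enorm _ _) _.
  by rewrite -mulrA ler_wpM2l// mulrC ler_wpM2r ?sqrtr_ge0// vS.
have fvint : mu.-integrable U (EFin \o (fun x => dotp (f x) (v x))).
  apply: le_integrable Sfint => //.
    exact/measurable_EFinP/measurable_dotp.
  by move=> x Ux; rewrite /= lee_fin (le_trans (fvS x Ux))// ler_norm.
have vvint : mu.-integrable U (EFin \o (fun x => dotp (v x) (v x))).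
  apply: measurable_bounded_integrable => //; first exact: measurable_dotp.
  exists (S ^+ 2); split; first exact: num_real.
  move=> M SM x Ux; rewrite /= ger0_norm ?dotp_ge0// -sqr_enorm.
  apply: le_trans (ltW SM); rewrite lerXn2r ?nnegrE ?sqrtr_ge0//.
  exact: vS.
(* Orthogonality tested with [v] itself. *)
have IfE : I = \int[mu]_(x in U) dotp (f x) (v x).
  apply/eqP; rewrite -subr_eq0 -RintegralB// -orth; apply/eqP.
  by apply: eq_Rintegral => x _; rewrite dotpBl.
have ISN : I <= n%:R * S * N.
  rewrite IfE -RintegralZl//; apply: le_Rintegral => //.
  by move=> x Ux; apply: le_trans (fvS x Ux); exact: ler_norm.
have SS : S * S <= n%:R * k * N * S.
  rewrite -expr2 sqr_sqrtr ?mulr_ge0//.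
  by apply: le_trans (ler_wpM2l k0 ISN) _; rewrite le_eqVlt; apply/orP; left;
    apply/eqP; ring.
move=> x Ux; apply: (le_trans (vS x Ux)).
have [->|SN0] := eqVneq S 0; first by rewrite !mulr_ge0.
by move: SS; rewrite ler_pM2r// lt_neqAle eq_sym SN0.
Qed.

End orthogonality.

(** * Vector-valued polynomials on [U] *)

Section vector_polynomials.
Context {R : realType} {d n l : nat}.
Variables (U : set 'rV[R]_d) (v : 'rV[R]_d -> 'rV[R]_n).
Hypotheses (mU : measurable U) (vU : vpoly U l v).

Lemma measurable_vpoly i : measurable_fun U (fun x => v x ord0 i).
Proof.
have [q [_ vE]] := vU.
apply: eq_measurable_fun (measurable_funTS (measurable_meval (q i))).
by move=> x; rewrite inE => Ux; rewrite vE.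
Qed.

Lemma vpoly_bounded : bounded_set U ->
  exists c, forall x, U x -> enorm (v x) <= c.
Proof.
have [q [_ vE]] := vU => /bounded_coord[B _ UB].
have /choice[c cP] := fun i => meval_bounded (q i) B.
exists (\sum_i c i) => x Ux; apply: le_trans (enorm_le_sum_norm _) _.
by apply: ler_sum => i _; rewrite vE//; apply: cP; exact: UB.
Qed.

Lemma vpoly_inverse (a : 'rV[R]_d) (s M : R) : 0 < s -> 0 <= M -> box a s `<=` U ->
  (forall x, U x -> forall i, `|x ord0 i - a ord0 i| <= M * s) ->
  forall x, U x -> ((enorm (v x) ^+ 2)%:E <=
    ((inverse_cst l M / s) ^+ d)%:E *
      \int[lebesgue_rV d]_(y in U) (dotp (v y) (v y))%:E)%E.
Proof.
move=> s0 M0 aU UM x Ux; have [q [ql vE]] := vU.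
set k := _ ^+ d; have k0 : 0 <= k.
  by rewrite exprn_ge0// divr_ge0 ?ltW// inverse_cst_gt0.
(* Outside [U] nothing is known of [v], so the globally defined polynomials replace it; the two
   agree on the box, which lies in [U]. *)
pose f i (y : 'rV[R]_d) := mpoly.meval (y ord0) (q i).
have mf i : measurable_fun setT (f i) by exact: measurable_meval.
have mfB i : measurable_fun setT (fun y => (f i y ^+ 2 * box_indic a s y)%:E).
  apply/measurable_EFinP; apply: measurable_funM; first exact: measurable_funX.
  exact: measurable_box_indic.
have fB0 i y : (0 <= (f i y ^+ 2 * box_indic a s y)%:E)%E.
  by rewrite lee_fin mulr_ge0 ?sqr_ge0 ?box_indic_ge0.
apply: (@le_trans _ _ (\sum_(i < n)
    k%:E * \int[lebesgue_rV d]_y (f i y ^+ 2 * box_indic a s y)%:E)%E).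
  rewrite sqr_enorm /dotp -sumEFin; apply: lee_sum => i _.
  rewrite -expr2 vE//; apply: separately_poly_inverse => //.
  - exact: meval_separately_poly.
  - exact: UM.
rewrite -ge0_sume_distrr; last by move=> i _; exact: integral_ge0.
apply: lee_wpmul2l; first by rewrite lee_fin.
rewrite -ge0_integral_sum// [leRHS]integral_mkcond.
have mvv : measurable_fun U (fun y => (dotp (v y) (v y))%:E).
  by apply/measurable_EFinP; apply: measurable_dotp => // i; exact: measurable_vpoly.
apply: ge0_le_integral => //.
- by move=> y _; exact: sume_ge0.
- exact: emeasurable_sum.
- exact: (measurable_restrictT _ mU).1.
move=> y _; rewrite sumEFin -mulr_suml box_indicE indicE patchE.
have [yB|yB] := boolP (y \in box a s); last first.
  by rewrite mulr0; case: ifPn => _; [rewrite lee_fin dotp_ge0 | exact: lexx].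
have Uy : U y by apply: aU; rewrite inE in yB.
rewrite mulr1 mem_set// lee_fin /dotp le_eqVlt; apply/orP; left; apply/eqP.
by apply: eq_bigr => i _; rewrite vE.
Qed.

End vector_polynomials.

(** * Vector-valued Lebesgue spaces on [U] *)

Section support.
Context {R : realType} {d n : nat}.
Variables (U : set 'rV[R]_d) (m : R).
Hypotheses (mU : measurable U) (m0 : 0 < m) (Um : lebesgue_rV d U = m%:E).
Implicit Types (f g : 'rV[R]_d -> 'rV[R]_n) (p : \bar R).

Lemma restrict_out (h : 'rV[R]_d -> R) x : ~ U x -> (h \_ U) x = 0.
Proof. by move=> Ux; rewrite patchE memNset. Qed.

Lemma measurable_restrict_coord p f i : Lp U p f ->
  measurable_fun U (fun x => f x ord0 i).
Proof.
move=> /(_ i); rewrite inE => /andP[]; rewrite inE/= => mf _.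
exact/(measurable_restrictT _ mU).
Qed.

Lemma Lp_sub_L1 p f : (1 <= p)%E -> Lp U p f -> Lp U 1%E f.
Proof.
move=> p1 fp i; have := fp i; rewrite !inE => /andP[]; rewrite !inE/= => mf fin.
apply/andP; split; rewrite inE//= /finite_norm.
have c0 : 0 < m `^ (fine p)^-1 by exact: powR_gt0.
have := Lnorm1_le mU Um p1 m0 mf (@restrict_out _).
move: fin; rewrite /finite_norm; set a := Lnorm _ p _; set b := Lnorm _ 1%E _ => fin.
(* An infinite norm in L^1 would make the left side of [Lnorm1_le] infinite while the right side is
   finite. *)
rewrite ltey; apply: contraTneq => ->.
by rewrite gt0_mulye ?lte_fin// -ltNge lte_mul_pinfty ?lee_fin ?(ltW m0).
Qed.

Lemma Lp_integrable f i : Lp U 1%E f ->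
  (lebesgue_rV d).-integrable U (fun x => (f x ord0 i)%:E).
Proof.
move=> /(_ i) /Lfun1_integrable; rewrite -restrict_EFin.
by move/(integrable_mkcond _ mU).
Qed.

Lemma measurable_restrict_enorm f :
  (forall i, measurable_fun U (fun x => f x ord0 i)) ->
  measurable_fun setT ((fun x => enorm (f x)) \_ U).
Proof. by move=> mf; apply/(measurable_restrictT _ mU)/measurable_enorm. Qed.

Lemma Lp_norm1E f : (forall i, (lebesgue_rV d).-integrable U (fun x => (f x ord0 i)%:E)) ->
  Lp_norm U 1%E f = (\int[lebesgue_rV d]_(x in U) enorm (f x))%:E.
Proof.
move=> fi; rewrite /Lp_norm Lnorm1 /Rintegral fineK.
  rewrite [RHS]integral_mkcond; apply: eq_integral => x _.
  rewrite /= !patchE; case: ifPn => _; last by rewrite normr0.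
  by rewrite ger0_norm ?sqrtr_ge0.
exact: integrable_fin_num (integrable_enorm mU fi).
Qed.

(** With [N] the L^1 norm of [f], the norm of [g] is at most [k * N] times [m] to the power [1 / p],
    and [N] times that power is at most [m] times the norm of [f]. The constant is thus independent
    of [p]. *)
Lemma Lp_norm_le_sup p f g (k : R) : (1 <= p)%E -> 0 <= k ->
  Lp U p f -> (forall i, measurable_fun U (fun x => g x ord0 i)) ->
  (forall x, U x -> enorm (g x) <= k * \int[lebesgue_rV d]_(y in U) enorm (f y)) ->
  (Lp_norm U p g <= (k * m)%:E * Lp_norm U p f)%E.
Proof.
move=> p1 k0 fp mg gk.
have fi i : (lebesgue_rV d).-integrable U (fun x => (f x ord0 i)%:E).
  by apply: Lp_integrable; exact: Lp_sub_L1 fp.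
have mf i := measurable_restrict_coord i fp.
set N := \int[_]_(y in U) _ in gk.
have N0 : 0 <= N by apply: Rintegral_ge0 => x _; exact: sqrtr_ge0.
apply: (@le_trans _ _ ((k * N) * m `^ (fine p)^-1)%:E).
  apply: (Lnorm_le_cst mU Um) => //.
  - exact: measurable_restrict_enorm.
  - exact: mulr_ge0.
  - exact: restrict_out.
  - apply/nearW => x; rewrite patchE; case: ifPn => [|_].
      by rewrite inE ger0_norm ?sqrtr_ge0//; exact: gk.
    by rewrite normr0 mulr_ge0.
rewrite -mulrA !EFinM -muleA lee_wpmul2l ?lee_fin//.
rewrite -(Lp_norm1E fi).
by apply: (Lnorm1_le mU Um p1 m0); [exact: measurable_restrict_enorm | exact: restrict_out].
Qed.

End support.


(** * Uniform stability of the projector *)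

Theorem lemma4 (R : realType) (d n l : nat) (delta : R) (p : \bar R) :
  (1 <= d)%N -> (1 <= n)%N -> 0 < delta -> (1 <= p)%E ->
  exists C : R, 0 < C /\
    forall (U : set 'rV[R]_d)
           (P : set ('rV[R]_d -> 'rV[R]_n))
           (Pi : ('rV[R]_d -> 'rV[R]_n) -> 'rV[R]_d -> 'rV[R]_n),
      open U -> bounded_set U -> connected U ->
      P `<=` vpoly U l -> submod_closed (mem P) ->
      is_L2_projector U P Pi ->
      delta <= inradius U / diameter U ->
      forall Phi, Lp U p Phi ->
        (Lp_norm U p (Pi Phi) <= C%:E * Lp_norm U p Phi)%E.
Proof.
move=> _ n0 delta0 p1.
(* Chosen so that [D <= M * s] follows from [delta * D / 2 < r] and [s = r / d.+1]. *)
pose M : R := 2 * d.+1%:R / delta.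
have M0 : 0 < M by rewrite divr_gt0// mulr_gt0.
pose K : R := inverse_cst l M.
have K0 : 0 < K by apply: inverse_cst_gt0; exact: ltW.
(* The factor [n * (K / s) ^+ d] of the sup bound, times the measure of [U], which is at most
   [(4 * D) ^+ d <= (4 * M * s) ^+ d]; the side [s] cancels. *)
exists (n%:R * (4 * M * K) ^+ d); split.
  by rewrite mulr_gt0 ?ltr0n// exprn_gt0// (mulr_gt0 _ K0)// (mulr_gt0 _ M0).
move=> U P Pi oU bU _ Pl _ PiP dU f fp.
have [x0 [r [r0 x0U D0 Dr]]] := inner_ball bU delta0 dU.
have mU := open_rV_measurable oU.
pose D := diameter U; pose s := r / d.+1%:R.
have s0 : 0 < s by rewrite divr_gt0.
have bxU : box x0 s `<=` U by apply: subset_trans x0U; exact: box_sub_eball.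
have Ux0 : U x0 by apply: x0U; exact: eball_center.
have DMs : D <= M * s.
  have -> : M * s = 2 * r / delta.
    by rewrite /M /s; field; rewrite nat1r pnatr_eq0 (gt_eqF delta0).
  by rewrite ler_pdivlMr//; move: Dr; rewrite -/D; lra.
have UM x : U x -> forall i, `|x ord0 i - x0 ord0 i| <= M * s.
  move=> Ux i; apply: le_trans DMs.
  apply: le_trans (enorm_le_diameter bU Ux Ux0).
  by have := coord_le_enorm (x - x0) i; rewrite !mxE.
have D40 : 0 <= 4 * D by rewrite mulr_ge0// ltW.
have UD : (lebesgue_rV d U <= ((4 * D) ^+ d)%:E)%E.
  rewrite -(lebesgue_box (\row_i (x0 ord0 i - 2 * D)))//.
  by apply: le_measure; rewrite ?inE//; [exact: measurable_box | exact: sub_box].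
have sU : ((s ^+ d)%:E <= lebesgue_rV d U)%E.
  rewrite -(lebesgue_box x0 (ltW s0)).
  by apply: le_measure; rewrite ?inE//; exact: measurable_box.
have Ufin : lebesgue_rV d U \is a fin_num.
  by rewrite ge0_fin_numE// (le_lt_trans UD)// ltry.
pose m := fine (lebesgue_rV d U).
have Um : lebesgue_rV d U = m%:E by rewrite fineK.
have m0 : 0 < m by rewrite -lte_fin -Um (lt_le_trans _ sU)// lte_fin exprn_gt0.
(* The projector is specified on L^1 only, which contains L^p because [U] has finite measure. *)
have f1 := Lp_sub_L1 mU m0 Um p1 fp.
have [Pf orth] := PiP f f1.
have vl := Pl _ Pf.
have mv i := measurable_vpoly vl i.
have [c vc] := vpoly_bounded vl bU.
(* The real-valued integral is [fine] of the extended one, so finiteness is needed to transfer the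
   inverse inequality; it holds because polynomials are bounded on [U]. *)
have vvint : (lebesgue_rV d).-integrable U (EFin \o (fun x => dotp (Pi f x) (Pi f x))).
  apply: measurable_bounded_integrable => //; first exact: le_lt_trans UD (ltry _).
    exact: measurable_dotp.
  exists (c ^+ 2); split; first exact: num_real.
  move=> B cB x Ux; rewrite /= ger0_norm ?dotp_ge0// -sqr_enorm.
  apply: le_trans (ltW cB); rewrite lerXn2r ?nnegrE ?sqrtr_ge0 ?vc//.
  by rewrite (le_trans _ (vc x Ux))// sqrtr_ge0.
pose k := (K / s) ^+ d.
have k0 : 0 <= k by rewrite exprn_ge0// divr_ge0 ?ltW.
have vk x : U x -> enorm (Pi f x) ^+ 2 <=
    k * \int[lebesgue_rV d]_(y in U) dotp (Pi f y) (Pi f y).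
  move=> Ux; rewrite -lee_fin [(k * _)%:E]EFinM /Rintegral fineK.
    exact: (vpoly_inverse mU vl s0 (ltW M0) bxU UM Ux).
  exact: integrable_fin_num vvint.
have vS := orthogonal_sup_bound mU k0 (le_lt_trans UD (ltry _))
  (fun i => Lp_integrable mU i f1) mv vk (orth _ Pf).
have nk0 : 0 <= n%:R * k by rewrite mulr_ge0.
apply: (le_trans (Lp_norm_le_sup mU m0 Um p1 nk0 fp mv vS)).
apply: lee_wpmul2r; first exact: Lnorm_ge0.
rewrite lee_fin -mulrA ler_wpM2l//.
apply: (@le_trans _ _ (k * (4 * D) ^+ d)).
  by rewrite ler_wpM2l// -lee_fin -Um.
rewrite /k -exprMn lerXn2r ?nnegrE//.
- by rewrite (mulr_ge0 _ D40)// divr_ge0 ?ltW.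
- by rewrite (mulr_ge0 _ (ltW K0))// (mulr_ge0 _ (ltW M0)).
have -> : K / s * (4 * D) = 4 * K / s * D by ring.
apply: (@le_trans _ _ (4 * K / s * (M * s))).
  by rewrite ler_wpM2l// (divr_ge0 _ (ltW s0))// (mulr_ge0 _ (ltW K0)).
by rewrite le_eqVlt; apply/orP; left; apply/eqP; field; rewrite (gt_eqF s0).
Qed.
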